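(* There exist a curve $\gamma:I\to\mathbb{R}^3_1$ parametrized by the arc length $s$, which verifies the Frenet equations $$\nabla_TT=\epsilon_2k_\gamma(s)N,\qquad \nabla_TN=-\epsilon_1k_\gamma(s)T+\epsilon_3\tau_\gamma(s)B,\qquad \nabla_TB=-\epsilon_2\tau_\gamma(s)N$$ with $\epsilon_3=1$, and a small $\delta>0$ such that the associated ruled surface $S_\gamma$, parametrized by $X(s,v)=\gamma(s)+v\,N(s)$ with $s\in I$, $v\in(-\delta,\delta)$, is a Lorentz surface and $\gamma(s)=X(s,0)$ is a proper triharmonic curve in $S_\gamma$ with non constant curvature $k(s)$.
   Context: $\mathbb{R}^3_1$ is $\mathbb{R}^3$ with the flat metric $\langle x,y\rangle=-x_1y_1+x_2y_2+x_3y_3$, and $\nabla$ in the Frenet equations is its Levi-Civita connection. $I$ is an open real interval, $T=\gamma'$, and $\{T,N,B\}$ is an orthonormal frame along $\gamma$: $\langle T,T\rangle=\epsilon_1$, $\langle N,N\rangle=\epsilon_2$, $\langle B,B\rangle=\epsilon_3$, each equal to $\pm1$, mutually orthogonal. The surface $S_\gamma$ is immersed in $\mathbb{R}^3_1$ by $X$ and carries the induced metric; it is a Lorentz surface if this metric is non-degenerate of index $1$. Triharmonicity and curvature of $\gamma$ in $S_\gamma$ are intrinsic to $S_\gamma$: let $\nabla^S$ be the Levi-Civita connection of $S_\gamma$ and $R(X,Y)Z=\nabla^S_X\nabla^S_YZ-\nabla^S_Y\nabla^S_XZ-\nabla^S_{[X,Y]}Z$ its curvature operator. Write $(\nabla^S_T)^0T=T$,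 $(\nabla^S_T)^jT=\nabla^S_T((\nabla^S_T)^{j-1}T)$. The curve is triharmonic in $S_\gamma$ if $$(\nabla^S_T)^{5}T+R\big((\nabla^S_T)^{3}T,T\big)T-R\big((\nabla^S_T)^{2}T,\nabla^S_T T\big)T=0,$$ and proper if it is moreover not a geodesic of $S_\gamma$. The curvature $k(s)$ of $\gamma$ in $S_\gamma$ is defined by the Frenet equations $\nabla^S_TT=\epsilon_2k(s)N$, $\nabla^S_TN=-\epsilon_1k(s)T$ in $S_\gamma$. *)

(* Defs.v *)
From Stdlib Require Export Reals.
From Coquelicot Require Export Coquelicot.

Local Open Scope R_scope.

(** * Curves in Minkowski 3-space *)

Definition R3 : Type := (R * R * R)%type.
Definition x1 (x : R3) : R := fst (fst x).
Definition x2 (x : R3) : R := snd (fst x).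
Definition x3 (x : R3) : R := snd x.

Definition mink (x y : R3) : R :=
  - x1 x * x1 y + x2 x * x2 y + x3 x * x3 y.

(** The interval may be unbounded, hence end points in [Rbar]. *)
Definition real_interval (a b : Rbar) (s : R) : Prop := Rbar_lt a s /\ Rbar_lt s b.

Definition is_sign (e : R) : Prop := e = 1 \/ e = -1.

Definition smooth_on (J : R -> Prop) (f : R -> R3) : Prop :=
  forall (n : nat) (s : R), J s ->
    ex_derive_n (fun t => x1 (f t)) n s /\
    ex_derive_n (fun t => x2 (f t)) n s /\
    ex_derive_n (fun t => x3 (f t)) n s.

(** The Levi-Civita connection of the flat metric is the ordinary derivative
    of the coordinates. *)
Record frenet_curve (J : R -> Prop) (e1 e2 e3 : R)
    (gamma T N B : R -> R3) (k tau : R -> R) : Prop := {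
  fc_e1 : is_sign e1;
  fc_e2 : is_sign e2;
  fc_e3 : is_sign e3;
  fc_smooth : smooth_on J gamma;
  fc_smooth_T : smooth_on J T;
  fc_smooth_N : smooth_on J N;
  fc_smooth_B : smooth_on J B;
  fc_TT : forall s, J s -> mink (T s) (T s) = e1;
  fc_NN : forall s, J s -> mink (N s) (N s) = e2;
  fc_BB : forall s, J s -> mink (B s) (B s) = e3;
  fc_TN : forall s, J s -> mink (T s) (N s) = 0;
  fc_TB : forall s, J s -> mink (T s) (B s) = 0;
  fc_NB : forall s, J s -> mink (N s) (B s) = 0;
  fc_velocity : forall s, J s -> is_derive gamma s (T s);
  fc_dT : forall s, J s -> is_derive T s (scal (e2 * k s) (N s));
  fc_dN : forall s, J s ->
    is_derive N s (plus (scal (- e1 * k s) (T s)) (scal (e3 * tau s) (B s)));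
  fc_dB : forall s, J s -> is_derive B s (scal (- e2 * tau s) (N s))
}.

(** * Intrinsic geometry of a surface in a coordinate chart

    A surface is described in one chart with coordinates [(s, v)] ranging over
    a domain [D]; tensors are given by their components in the coordinate
    frame, indexed by [coord]. *)

Inductive coord : Set := cs | cv.

Definition sumc (f : coord -> R) : R := f cs + f cv.

Definition pd (i : coord) (f : R -> R -> R) (s v : R) : R :=
  match i with
  | cs => Derive (fun t => f t v) s
  | cv => Derive (fun t => f s t) v
  end.

Definition tvec : Type := coord -> R.
Definition vfield : Type := R -> R -> tvec.
Definition metric : Type := coord -> coord -> R -> R -> R.

Definition coord_field (i : coord) : vfield := fun _ _ j =>
  match i, j with
  | cs, cs => 1
  | cv, cv => 1
  | _, _ => 0
  end.

Definition inner (g : metric) (s v : R) (w z : tvec) : R :=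
  sumc (fun i => sumc (fun j => g i j s v * w i * z j)).

Definition nondegenerate (g : metric) (s v : R) : Prop :=
  forall w : tvec, (forall z : tvec, inner g s v w z = 0) -> forall i, w i = 0.

(** The index is the largest dimension of a subspace on which the form is
    negative definite; on a plane it is 1 iff some vector (line) is negative
    but the whole plane is not negative definite. *)
Definition index_one (g : metric) (s v : R) : Prop :=
  (exists w : tvec, inner g s v w w < 0) /\
  ~ (forall w : tvec, (exists i, w i <> 0) -> inner g s v w w < 0).

Definition lorentz (D : R -> R -> Prop) (g : metric) : Prop :=
  forall s v, D s v -> nondegenerate g s v /\ index_one g s v.

(** [C i j k] is the [k]-th component of the covariant derivative of the
    [j]-th coordinate field along the [i]-th one. *)
Definition connection : Type := coord -> coord -> coord -> R -> R -> R.

Definition nabla (C : connection) (X Y : vfield) : vfield := fun s v k =>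
  sumc (fun i => X s v i *
    (pd i (fun s' v' => Y s' v' k) s v + sumc (fun j => C i j k s v * Y s v j))).

Definition bracket (X Y : vfield) : vfield := fun s v k =>
  sumc (fun i => X s v i * pd i (fun s' v' => Y s' v' k) s v
               - Y s v i * pd i (fun s' v' => X s' v' k) s v).

(** Torsion-free and compatible with [g]. Both conditions are tensorial, so
    they are only required on the coordinate fields. On an open domain where
    [g] is smooth and nondegenerate there is exactly one such [C]. *)
Definition levi_civita (D : R -> R -> Prop) (g : metric) (C : connection) : Prop :=
  forall s v, D s v ->
    (forall i j k,
       nabla C (coord_field i) (coord_field j) s v k
       - nabla C (coord_field j) (coord_field i) s v k
       = bracket (coord_field i) (coord_field j) s v k) /\
    (forall i j l,
       pd i (fun s' v' => inner g s' v' (coord_field j s' v') (coord_field l s' v')) s v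
       = inner g s v (nabla C (coord_field i) (coord_field j) s v) (coord_field l s v)
       + inner g s v (coord_field j s v) (nabla C (coord_field i) (coord_field l) s v)).

Definition curvature_operator (C : connection) (X Y Z : vfield) : vfield := fun s v k =>
  nabla C X (nabla C Y Z) s v k - nabla C Y (nabla C X Z) s v k
  - nabla C (bracket X Y) Z s v k.

(** The value of the curvature operator on tangent vectors at a point; by
    tensoriality any extension to vector fields may be used, here the one with
    constant components. *)
Definition curvature_at (C : connection) (p : R * R) (x y z : tvec) : tvec :=
  curvature_operator C (fun _ _ => x) (fun _ _ => y) (fun _ _ => z) (fst p) (snd p).

(** ** Curves in the chart *)

Definition velocity (c : R -> R * R) (s : R) : tvec := fun i =>
  match i with
  | cs => Derive (fun t => fst (c t)) s
  | cv => Derive (fun t => snd (c t)) s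
  end.

(** Covariant derivative along [c] of a vector field [V] along [c]. *)
Definition cov_along (C : connection) (c : R -> R * R) (V : R -> tvec) : R -> tvec :=
  fun s k =>
    Derive (fun t => V t k) s
    + sumc (fun i => sumc (fun j =>
        C i j k (fst (c s)) (snd (c s)) * velocity c s i * V s j)).

Definition cov_iter (C : connection) (c : R -> R * R) (n : nat) : R -> tvec :=
  Nat.iter n (cov_along C c) (velocity c).

Definition triharmonic (J : R -> Prop) (C : connection) (c : R -> R * R) : Prop :=
  forall s, J s -> forall i,
    cov_iter C c 5 s i
    + curvature_at C (c s) (cov_iter C c 3 s) (cov_iter C c 0 s) (cov_iter C c 0 s) i
    - curvature_at C (c s) (cov_iter C c 2 s) (cov_iter C c 1 s) (cov_iter C c 0 s) i
    = 0.

Definition geodesic (J : R -> Prop) (C : connection) (c : R -> R * R) : Prop :=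
  forall s, J s -> forall i, cov_along C c (velocity c) s i = 0.

Definition proper_triharmonic (J : R -> Prop) (C : connection) (c : R -> R * R) : Prop :=
  triharmonic J C c /\ ~ geodesic J C c.

(** * Surfaces parametrized in Minkowski 3-space *)

Definition dX (X : R -> R -> R3) (i : coord) (s v : R) : R3 :=
  (pd i (fun s' v' => x1 (X s' v')) s v,
   pd i (fun s' v' => x2 (X s' v')) s v,
   pd i (fun s' v' => x3 (X s' v')) s v).

Definition push (X : R -> R -> R3) (p : R * R) (w : tvec) : R3 :=
  plus (scal (w cs) (dX X cs (fst p) (snd p))) (scal (w cv) (dX X cv (fst p) (snd p))).

Definition immersion (D : R -> R -> Prop) (X : R -> R -> R3) : Prop :=
  forall s v, D s v -> forall w : tvec, push X (s, v) w = zero -> forall i, w i = 0.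

Definition induced_metric (X : R -> R -> R3) : metric := fun i j s v =>
  mink (dX X i s v) (dX X j s v).

(** [k] is the curvature in the surface of the curve [c], with normal [N] (a
    field in the ambient space, required to be tangent to the surface). *)
Definition frenet_in_surface (J : R -> Prop) (X : R -> R -> R3) (C : connection)
    (e1 e2 : R) (c : R -> R * R) (N : R -> R3) (k : R -> R) : Prop :=
  exists n : R -> tvec, forall s, J s ->
    push X (c s) (n s) = N s /\
    (forall i, cov_along C c (velocity c) s i = e2 * k s * n s i) /\
    (forall i, cov_along C c n s i = - e1 * k s * velocity c s i).

Definition non_constant (J : R -> Prop) (k : R -> R) : Prop :=
  exists s t, J s /\ J t /\ k s <> k t.

Definition ruled (gamma N : R -> R3) (s v : R) : R3 := plus (gamma s) (scal v (N s)).

Definition strip (J : R -> Prop) (delta : R) (s v : R) : Prop :=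
  J s /\ - delta < v < delta.

(** The base curve of a ruled surface, in the chart. *)
Definition base_curve (s : R) : R * R := (s, 0).

(* Main.v *)
Require Import Defs.
From Stdlib Require Import Lra Lia List Classical.
Open Scope R_scope.

(** For [(e1, e2, e3) = (-1, 1, 1)] the induced metric of the ruled surface is
    [E ds^2 + dv^2] with [E = - (1 + v k)^2 + v^2 tau^2], and along the base curve
    its Gauss curvature is [tau^2]. The tangential part of the triharmonic
    equation is [k k''' + 2 k' k'' + 2 k^3 k' = 0], i.e. [k^2 k'' + (2/5) k^5] is
    constant. When this constant is [0] and [w = k'/k], the equation becomes
    [k' = k w], [w' = - w^2 - (2/5) k^2], and the normal part reduces to
    [tau^2 = (63/8) (w^2 - k^2/5)]. This relation is the first integral of a
    polynomial system which, joined to the Frenet equations, is solved by power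
    series. *)

(** * Polynomial differential systems *)

Section PolynomialODE.

Context {I : Type}.

Inductive pexpr : Type :=
| PCst (c : R)
| PVar (i : I)
| PAdd (p q : pexpr)
| PMul (p q : pexpr).

Fixpoint peval (y : I -> R) (p : pexpr) : R :=
  match p with
  | PCst c => c
  | PVar i => y i
  | PAdd p q => peval y p + peval y q
  | PMul p q => peval y p * peval y q
  end.

Fixpoint pcoef (a : I -> nat -> R) (p : pexpr) : nat -> R :=
  match p with
  | PCst c => fun n => match n with O => c | S _ => 0 end
  | PVar i => a i
  | PAdd p q => PS_plus (pcoef a p) (pcoef a q)
  | PMul p q => PS_mult (pcoef a p) (pcoef a q)
  end.

(** Cauchy products only look backwards. This is what lets the Taylor coefficients of a solution of
    y' = f(y) be computed one after the other. *)
Lemma pcoef_ext (a b : I -> nat -> R) (p : pexpr) (n : nat) :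
  (forall i m, (m <= n)%nat -> a i m = b i m) -> pcoef a p n = pcoef b p n.
Proof.
revert n; induction p as [c | i | p IHp q IHq | p IHp q IHq]; intros n H; simpl.
- reflexivity.
- now apply H.
- unfold PS_plus; now rewrite IHp, IHq.
- unfold PS_mult; apply sum_eq; intros j Hj.
  rewrite IHp, IHq; [reflexivity | |]; intros i m Hm; apply H; lia.
Qed.

(** The weight [1 / (n + 1)^2] makes the bound stable under Cauchy products,
    hence under every polynomial. *)
Definition majorized (r A : R) (a : nat -> R) (n : nat) : Prop :=
  Rabs (a n) <= A * r ^ n / INR (S n) ^ 2.

(** Telescoping comparison: 1/(x+1)^2 <= 1/x - 1/(x+1). *)
Lemma sum_inv_sqr_le (n : nat) :
  sum_f_R0 (fun i => / INR (S i) ^ 2) n <= 2 - / INR (S n).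
Proof.
induction n as [| n IHn]; [simpl; lra |].
rewrite tech5.
assert (Hn : 0 < INR (S n)) by (apply lt_0_INR; lia).
rewrite (S_INR (S n)).
enough (/ (INR (S n) + 1) ^ 2 <= / INR (S n) - / (INR (S n) + 1)) by lra.
set (x := INR (S n)) in *.
replace (/ x - / (x + 1)) with (/ (x * (x + 1))) by (field; lra).
apply Rinv_le_contravar; nra.
Qed.

(** Write x = i + 1, y = n - i + 1 and z = n + 1. Since z <= x + y, one has z^2 <= 2 (x^2 + y^2), so
    1/(x^2 y^2) <= (1/x^2 + 1/y^2) (2/z^2). Each of the two inverse square sums is at most 2, hence
    the constant 8. *)
Lemma sum_weights_le (n : nat) :
  sum_f_R0 (fun i => / INR (S i) ^ 2 * / INR (S (n - i)) ^ 2) n <= 8 / INR (S n) ^ 2.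
Proof.
assert (Hn : 0 < INR (S n)) by (apply lt_0_INR; lia).
apply Rle_trans with
  (sum_f_R0 (fun i => (/ INR (S i) ^ 2 + / INR (S (n - i)) ^ 2) * (2 / INR (S n) ^ 2)) n).
- apply sum_Rle; intros i Hi.
  assert (Hx : 0 < INR (S i)) by (apply lt_0_INR; lia).
  assert (Hy : 0 < INR (S (n - i))) by (apply lt_0_INR; lia).
  assert (Hxy : INR (S n) <= INR (S i) + INR (S (n - i)))
    by (rewrite <- plus_INR; apply le_INR; lia).
  set (x := INR (S i)) in *; set (y := INR (S (n - i))) in *; set (z := INR (S n)) in *.
  replace ((/ x ^ 2 + / y ^ 2) * (2 / z ^ 2))
    with (/ x ^ 2 * / y ^ 2 * ((2 * (x ^ 2 + y ^ 2)) / z ^ 2)) by (field; lra).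
  rewrite <- (Rmult_1_r (/ x ^ 2 * / y ^ 2)) at 1.
  apply Rmult_le_compat_l.
  + apply Rmult_le_pos; left; apply Rinv_0_lt_compat; nra.
  + apply Rle_div_r; [nra |].
    pose proof (pow_incr z (x + y) 2 (conj (Rlt_le _ _ Hn) Hxy)).
    pose proof (pow2_ge_0 (x - y)); nra.
- rewrite <- scal_sum, plus_sum.
  rewrite (sum_f_R0_skip (fun i => / INR (S i) ^ 2)).
  pose proof (sum_inv_sqr_le n) as Hs.
  assert (0 < / INR (S n)) by now apply Rinv_0_lt_compat.
  assert (0 < / INR (S n) ^ 2) by (apply Rinv_0_lt_compat; nra).
  unfold Rdiv; nra.
Qed.

Lemma majorized_mult (r A B : R) (a b : nat -> R) (n : nat) :
  0 < r -> 0 <= A -> 0 <= B ->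
  (forall m, (m <= n)%nat -> majorized r A a m) ->
  (forall m, (m <= n)%nat -> majorized r B b m) ->
  majorized r (8 * A * B) (PS_mult a b) n.
Proof.
intros Hr HA HB Ha Hb; unfold majorized, PS_mult.
eapply Rle_trans; [apply Rsum_abs |].
apply Rle_trans with
  (sum_f_R0 (fun i => / INR (S i) ^ 2 * / INR (S (n - i)) ^ 2 * (A * B * r ^ n)) n).
- apply sum_Rle; intros i Hi.
  rewrite Rabs_mult.
  eapply Rle_trans.
  + apply Rmult_le_compat; [apply Rabs_pos | apply Rabs_pos | |].
    * apply Ha; lia.
    * apply Hb; lia.
  + right.
    replace (r ^ n) with (r ^ i * r ^ (n - i)) by (rewrite <- pow_add; f_equal; lia).
    unfold Rdiv; ring.
- rewrite <- scal_sum.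
  replace (8 * A * B * r ^ n / INR (S n) ^ 2)
    with (A * B * r ^ n * (8 / INR (S n) ^ 2)) by (unfold Rdiv; ring).
  apply Rmult_le_compat_l, sum_weights_le.
  apply Rmult_le_pos; [nra |]; now apply pow_le, Rlt_le.
Qed.

(** A majorizing constant for [p] when every variable is majorized with constant [A]. The factor 8
    is the price of a Cauchy product. *)
Fixpoint psize (A : R) (p : pexpr) : R :=
  match p with
  | PCst c => Rabs c
  | PVar _ => A
  | PAdd p q => psize A p + psize A q
  | PMul p q => 8 * psize A p * psize A q
  end.

Lemma psize_pos (A : R) (p : pexpr) : 0 <= A -> 0 <= psize A p.
Proof.
intros HA; induction p; simpl; [apply Rabs_pos | assumption | lra | nra].
Qed.

Lemma majorized_pcoef (r A : R) (a : I -> nat -> R) (p : pexpr) (n : nat) :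
  0 < r -> 0 <= A ->
  (forall i m, (m <= n)%nat -> majorized r A (a i) m) ->
  majorized r (psize A p) (pcoef a p) n.
Proof.
intros Hr HA; revert n.
induction p as [c | i | p IHp q IHq | p IHp q IHq]; intros n Ha; simpl.
- unfold majorized; destruct n as [| n].
  + simpl; right; field.
  + rewrite Rabs_R0.
    apply Rmult_le_pos.
    * apply Rmult_le_pos; [apply Rabs_pos | now apply pow_le, Rlt_le].
    * left; apply Rinv_0_lt_compat, pow_lt, lt_0_INR; lia.
- now apply Ha.
- unfold majorized, PS_plus in *.
  change (plus (pcoef a p n) (pcoef a q n)) with (pcoef a p n + pcoef a q n).
  eapply Rle_trans; [apply Rabs_triang |].
  specialize (IHp n Ha); specialize (IHq n Ha).
  unfold Rdiv in *; lra.
- apply majorized_mult; trivial; try now apply psize_pos.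
  + intros m Hm; apply IHp; intros; apply Ha; lia.
  + intros m Hm; apply IHq; intros; apply Ha; lia.
Qed.

Lemma majorized_CV_radius (r A : R) (a : nat -> R) :
  0 < r -> 0 <= A -> (forall n, majorized r A a n) -> Rbar_le (/ r) (CV_radius a).
Proof.
intros Hr HA Ha.
apply (proj1 (CV_radius_bounded a)).
exists A; intros n.
rewrite Rabs_mult, (Rabs_right ((/ r) ^ n)).
2: apply Rle_ge, pow_le; left; now apply Rinv_0_lt_compat.
assert (Hp : 0 < r ^ n) by now apply pow_lt.
rewrite pow_inv.
apply Rle_div_l; [assumption |].
eapply Rle_trans; [apply Ha |].
assert (H1 : 1 <= INR (S n)) by (apply (le_INR 1); lia).
apply Rle_div_l; [nra |].
assert (0 <= A * r ^ n) by nra.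
assert (1 <= INR (S n) ^ 2) by nra.
nra.
Qed.

(** Every subexpression inherits a majorization with the same ratio [r], so all the series involved
    converge on the same disc and may be added and multiplied there. *)
Lemma PSeries_pcoef (r A : R) (a : I -> nat -> R) (p : pexpr) (s : R) :
  0 < r -> 0 <= A -> (forall i n, majorized r A (a i) n) -> Rabs s < / r ->
  PSeries (pcoef a p) s = peval (fun i => PSeries (a i) s) p.
Proof.
intros Hr HA Ha Hs.
assert (Hcv : forall q, Rbar_lt (Rabs s) (CV_radius (pcoef a q))).
{ intros q; apply Rbar_lt_le_trans with (/ r); [exact Hs |].
  apply majorized_CV_radius with (psize A q); trivial.
  - now apply psize_pos.
  - intros n; now apply majorized_pcoef. }
induction p as [c | i | p IHp q IHq | p IHp q IHq]; simpl.
- rewrite PSeries_decr_1.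
  + rewrite (PSeries_ext _ (fun _ => 0)), PSeries_const_0; [ring |].
    now intros [| n].
  + exact (CV_radius_inside _ _ (Hcv (PCst c))).
- reflexivity.
- rewrite PSeries_plus, IHp, IHq; try apply CV_radius_inside; trivial.
- now rewrite PSeries_mult, IHp, IHq.
Qed.

(** * Power series solution of a polynomial initial value problem *)

Variables (f : I -> pexpr) (y0 : I -> R).

(** Course-of-values recursion made structural: [ode_prefix n] holds the true coefficients up to
    index [n], and filler values beyond. *)
Fixpoint ode_prefix (n : nat) : I -> nat -> R :=
  match n with
  | O => fun i _ => y0 i
  | S n' => fun i m =>
      if (m <=? n')%nat then ode_prefix n' i m
      else pcoef (ode_prefix n') (f i) n' / INR (S n')
  end.

Definition ode_coef (i : I) (n : nat) : R := ode_prefix n i n.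

Lemma ode_prefix_stable (n m : nat) (i : I) :
  (m <= n)%nat -> ode_prefix n i m = ode_coef i m.
Proof.
induction n as [| n IHn]; intros H.
- now replace m with O by lia.
- destruct (Nat.eq_dec m (S n)) as [-> | Hm]; [reflexivity |].
  simpl; replace (m <=? n)%nat with true by (symmetry; apply Nat.leb_le; lia).
  apply IHn; lia.
Qed.

Lemma ode_coef_S (i : I) (n : nat) :
  ode_coef i (S n) = pcoef ode_coef (f i) n / INR (S n).
Proof.
unfold ode_coef at 1; cbn [ode_prefix].
replace (S n <=? n)%nat with false by (symmetry; apply Nat.leb_gt; lia).
f_equal; apply pcoef_ext; intros; now apply ode_prefix_stable.
Qed.

(** Integrating a series divides its coefficient by n + 1, which more than pays for the change of
    weight up to the factor 4. The spare factor [r] in the next power then absorbs 4 times the size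
    of the right-hand side. *)
Lemma majorized_ode_coef (r A : R) :
  0 < r -> 0 <= A -> (forall i, Rabs (y0 i) <= A) ->
  (forall i, 4 * psize A (f i) <= r * A) ->
  forall n i, majorized r A (ode_coef i) n.
Proof.
intros Hr HA H0 Hf n.
induction n as [n IHn] using (well_founded_induction Wf_nat.lt_wf); intros i.
destruct n as [| n].
- unfold majorized; change (ode_coef i 0) with (y0 i).
  simpl; eapply Rle_trans; [apply H0 | right; field].
- unfold majorized; rewrite ode_coef_S.
  assert (Hn : majorized r (psize A (f i)) (pcoef ode_coef (f i)) n).
  { apply majorized_pcoef; trivial; intros; apply IHn; lia. }
  unfold majorized in Hn.
  assert (Hx : 1 <= INR (S n)) by (apply (le_INR 1); lia).
  rewrite (S_INR (S n)).
  specialize (Hf i); pose proof (psize_pos A (f i) HA) as HM.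
  set (x := INR (S n)) in *; set (M := psize A (f i)) in *.
  rewrite Rabs_div, (Rabs_right x); try lra.
  assert (Hp : 0 < r ^ n) by now apply pow_lt.
  apply Rle_trans with (M * r ^ n / x ^ 2 / x).
  { apply Rmult_le_compat_r; [left; apply Rinv_0_lt_compat; lra | exact Hn]. }
  apply Rle_trans with (M * r ^ n * (4 / (x + 1) ^ 2)).
  { replace (M * r ^ n / x ^ 2 / x) with (M * r ^ n * / x ^ 3) by (field; lra).
    apply Rmult_le_compat_l; [nra |].
    apply Rle_div_r; [nra |].
    rewrite Rmult_comm; apply (Rle_div_l ((x + 1) ^ 2) 4 (x ^ 3)); [nra |].
    (* The product is the factorization of 4 x^3 - (x + 1)^2, nonnegative for x >= 1. *)
    enough (0 <= (x - 1) * (4 * x ^ 2 + 3 * x + 1)) by nra.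
    apply Rmult_le_pos; nra. }
  simpl pow; unfold Rdiv.
  replace (A * (r * r ^ n) * / ((x + 1) * ((x + 1) * 1)))
    with (r * A * (r ^ n * / (x + 1) ^ 2)) by (field; lra).
  replace (M * r ^ n * (4 * / ((x + 1) * ((x + 1) * 1))))
    with (4 * M * (r ^ n * / (x + 1) ^ 2)) by (field; lra).
  apply Rmult_le_compat_r; [| exact Hf].
  apply Rmult_le_pos; [lra | left; apply Rinv_0_lt_compat; nra].
Qed.

Lemma list_upper_bound (g : I -> R) (l : list I) :
  exists M, 0 <= M /\ forall i, In i l -> g i <= M.
Proof.
induction l as [| j l [M [HM Hl]]].
- exists 0; split; [lra | now intros i []].
- exists (Rmax M (g j)); split.
  + apply Rle_trans with M; [exact HM | apply Rmax_l].
  + intros i [<- | Hi]; [apply Rmax_r |].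
    eapply Rle_trans; [now apply Hl | apply Rmax_l].
Qed.

Theorem polynomial_ode_solution (l : list I) :
  (forall i, In i l) ->
  exists (rho : R) (y : I -> R -> R),
    0 < rho /\
    (forall i, y i 0 = y0 i) /\
    (forall i n s, Rabs s < rho -> ex_derive_n (y i) n s) /\
    (forall i s, Rabs s < rho -> is_derive (y i) s (peval (fun j => y j s) (f i))).
Proof.
intros Hl.
destruct (list_upper_bound (fun i => Rabs (y0 i)) l) as [A0 [HA0 Hy0]].
set (A := A0 + 1).
destruct (list_upper_bound (fun i => psize A (f i)) l) as [M [HM Hf]].
(* This gives r A = 4 M + A >= 4 M, the growth condition of [majorized_ode_coef]. The added 1 here
   and in [A] keeps both constants positive. *)
set (r := 4 * M / A + 1).
assert (HA : 0 < A) by (unfold A; lra).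
assert (Hr : 0 < r).
{ unfold r.
  assert (0 <= 4 * M / A) by (apply Rdiv_le_0_compat; lra); lra. }
assert (Hmaj : forall i n, majorized r A (ode_coef i) n).
{ intros i n; apply majorized_ode_coef; try lra.
  - intros j; specialize (Hy0 j (Hl j)); unfold A; simpl in Hy0; lra.
  - intros j; specialize (Hf j (Hl j)); simpl in Hf.
    replace (r * A) with (4 * M + A) by (unfold r; field; lra); lra. }
assert (Hcv : forall i s, Rabs s < / r -> Rbar_lt (Rabs s) (CV_radius (ode_coef i))).
{ intros i s Hs; apply Rbar_lt_le_trans with (/ r); [exact Hs |].
  apply majorized_CV_radius with A; trivial; lra. }
exists (/ r), (fun i => PSeries (ode_coef i)); split; [| split; [| split]].
- now apply Rinv_0_lt_compat.
- intros i; now rewrite PSeries_0.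
- intros i n s Hs; now apply ex_derive_n_PSeries, Hcv.
- intros i s Hs.
  rewrite <- (PSeries_pcoef r A); trivial; try lra.
  rewrite (PSeries_ext _ (PS_derive (ode_coef i))).
  + now apply is_derive_PSeries, Hcv.
  + intros n; unfold PS_derive; rewrite ode_coef_S; field.
    apply not_0_INR; lia.
Qed.

End PolynomialODE.
Arguments pexpr : clear implicits.

(** * Ruled surfaces over curves with timelike tangent *)

Lemma mink_sym (x y : R3) : mink x y = mink y x.
Proof. unfold mink; ring. Qed.

Lemma mink_plus_l (x y z : R3) : mink (plus x y) z = mink x z + mink y z.
Proof.
change (- (x1 x + x1 y) * x1 z + (x2 x + x2 y) * x2 z + (x3 x + x3 y) * x3 z
  = mink x z + mink y z).
unfold mink; ring.
Qed.

Lemma mink_scal_l (c : R) (x y : R3) : mink (scal c x) y = c * mink x y.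
Proof.
change (- (c * x1 x) * x1 y + (c * x2 x) * x2 y + (c * x3 x) * x3 y = c * mink x y).
unfold mink; ring.
Qed.

Lemma mink_zero_l (y : R3) : mink zero y = 0.
Proof. change (- 0 * x1 y + 0 * x2 y + 0 * x3 y = 0); ring. Qed.

Lemma mink_plus_r (x y z : R3) : mink z (plus x y) = mink z x + mink z y.
Proof. rewrite mink_sym, mink_plus_l; f_equal; apply mink_sym. Qed.

Lemma mink_scal_r (c : R) (x y : R3) : mink y (scal c x) = c * mink y x.
Proof. rewrite mink_sym, mink_scal_l; f_equal; apply mink_sym. Qed.

Lemma is_derive_linear_comp {U V : NormedModule R_AbsRing} (L : U -> V)
    (f : R -> U) (s : R) (l : U) :
  is_linear L -> is_derive f s l -> is_derive (fun t => L (f t)) s (L l).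
Proof.
intros HL Hf; unfold is_derive in *.
apply filterdiff_ext_lin with (fun y => L (scal y l)).
- apply filterdiff_comp' with (1 := Hf); now apply filterdiff_linear.
- intros y; now apply linear_scal.
Qed.

Definition R3_module : NormedModule R_AbsRing :=
  prod_NormedModule R_AbsRing
    (prod_NormedModule R_AbsRing R_NormedModule R_NormedModule) R_NormedModule.

Lemma is_linear_x1 : is_linear x1.
Proof. apply (is_linear_comp fst fst); apply is_linear_fst. Qed.

Lemma is_linear_x2 : is_linear x2.
Proof. apply (is_linear_comp fst snd); [apply is_linear_fst | apply is_linear_snd]. Qed.

Lemma is_linear_x3 : is_linear x3.
Proof. apply is_linear_snd. Qed.

Lemma is_derive_pair {U V : NormedModule R_AbsRing} (f : R -> U) (g : R -> V)
    (s : R) (df : U) (dg : V) :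
  is_derive f s df -> is_derive g s dg ->
  is_derive (V := prod_NormedModule R_AbsRing U V) (fun t => (f t, g t)) s (df, dg).
Proof.
intros Hf Hg; unfold is_derive in *.
apply (filterdiff_comp'_2 f g (fun u v => (u, v)) s (fun y => scal y df)
  (fun y => scal y dg) (fun u v => (u, v)) Hf Hg).
apply filterdiff_linear, is_linear_prod; [apply is_linear_fst | apply is_linear_snd].
Qed.

Lemma surjective_R3 (x : R3) : (x1 x, x2 x, x3 x) = x.
Proof. now destruct x as [[? ?] ?]. Qed.

Lemma nabla_constant (C : connection) (x z : tvec) (s v : R) (l : coord) :
  nabla C (fun _ _ => x) (fun _ _ => z) s v l
  = sumc (fun i => x i * sumc (fun j => C i j l s v * z j)).
Proof.
unfold nabla, sumc, pd; rewrite !Derive_const; ring.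
Qed.

Lemma bracket_constant (x y : tvec) (s v : R) (l : coord) :
  bracket (fun _ _ => x) (fun _ _ => y) s v l = 0.
Proof.
unfold bracket, sumc, pd; rewrite !Derive_const; ring.
Qed.

(** * The ruled surface and its base curve, under the reduced equations for the curvature and
    torsion *)

Section RuledSurface.

Variables (J : R -> Prop) (gamma T N B : R -> R3) (k w tau : R -> R).

Hypothesis J_open : forall s, J s -> locally s J.
Hypothesis frenet : frenet_curve J (-1) 1 1 gamma T N B k tau.
Hypothesis k_derive : forall s, J s -> is_derive k s (k s * w s).
Hypothesis w_derive : forall s, J s -> is_derive w s (- w s ^ 2 - 2 / 5 * k s ^ 2).
Hypothesis tau_sqr : forall s, J s -> tau s ^ 2 = 63 / 8 * (w s ^ 2 - k s ^ 2 / 5).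

Definition Nprime (s : R) : R3 := plus (scal (k s) (T s)) (scal (tau s) (B s)).

Lemma dX_ruled_cs (s v : R) :
  J s -> dX (ruled gamma N) cs s v = plus (T s) (scal v (Nprime s)).
Proof.
intros Hs.
assert (HX : is_derive (fun t => ruled gamma N t v) s (plus (T s) (scal v (Nprime s)))).
{ unfold ruled; apply @is_derive_plus.
  - now apply (fc_velocity _ _ _ _ _ _ _ _ _ _ frenet).
  - apply (is_derive_linear_comp (U := R3_module) (V := R3_module) (scal v)).
    + apply (is_linear_scal_r (V := R3_module)), Rmult_comm.
    + pose proof (fc_dN _ _ _ _ _ _ _ _ _ _ frenet s Hs) as H.
      unfold Nprime; replace (- -1 * k s) with (k s) in H by ring.
      now rewrite Rmult_1_l in H. }
rewrite <- (surjective_R3 (plus (T s) (scal v (Nprime s)))).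
unfold dX, pd; f_equal; [f_equal |]; apply is_derive_unique.
- exact (is_derive_linear_comp (U := R3_module) (V := R_NormedModule) x1 _ _ _ is_linear_x1 HX).
- exact (is_derive_linear_comp (U := R3_module) (V := R_NormedModule) x2 _ _ _ is_linear_x2 HX).
- exact (is_derive_linear_comp (U := R3_module) (V := R_NormedModule) x3 _ _ _ is_linear_x3 HX).
Qed.

Lemma dX_ruled_cv (s v : R) : dX (ruled gamma N) cv s v = N s.
Proof.
assert (HX : is_derive (fun t => ruled gamma N s t) v (plus zero (N s))).
{ unfold ruled; apply @is_derive_plus.
  - apply (is_derive_const (K := R_AbsRing) (V := R3_module)).
  - apply filterdiff_linear, (is_linear_scal_l (V := R3_module)). }
rewrite (plus_zero_l (G := R3_module)) in HX.
rewrite <- (surjective_R3 (N s)).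
unfold dX, pd; f_equal; [f_equal |]; apply is_derive_unique.
- exact (is_derive_linear_comp (U := R3_module) (V := R_NormedModule) x1 _ _ _ is_linear_x1 HX).
- exact (is_derive_linear_comp (U := R3_module) (V := R_NormedModule) x2 _ _ _ is_linear_x2 HX).
- exact (is_derive_linear_comp (U := R3_module) (V := R_NormedModule) x3 _ _ _ is_linear_x3 HX).
Qed.

(** [- 1 - 2 v k + v^2 (tau^2 - k^2)], with [tau^2] eliminated so that
    the expression is differentiable by inspection. *)
Definition Ess (s v : R) : R :=
  - 1 - 2 * v * k s + v ^ 2 * (63 / 8 * w s ^ 2 - 103 / 40 * k s ^ 2).

(** The derivatives of [k] and [w] are already replaced by the right-hand sides of their
    differential equations. *)
Definition Ess_ds (s v : R) : R :=
  - 2 * v * (k s * w s)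
  - v ^ 2 * (63 / 4 * w s ^ 3 + 229 / 20 * (k s ^ 2 * w s)).

Definition Ess_dv (s v : R) : R :=
  - 2 * k s + 2 * v * (63 / 8 * w s ^ 2 - 103 / 40 * k s ^ 2).

Lemma Ess_frenet (s v : R) :
  J s -> Ess s v = - (1 + v * k s) ^ 2 + (v * tau s) ^ 2.
Proof.
intros Hs; rewrite (Rpow_mult_distr v (tau s)), tau_sqr by exact Hs.
unfold Ess; field.
Qed.

Lemma is_derive_Ess_s (s v : R) : J s -> is_derive (fun t => Ess t v) s (Ess_ds s v).
Proof.
intros Hs; unfold Ess.
pose proof (k_derive s Hs) as Hk; pose proof (w_derive s Hs) as Hw.
auto_derive.
- repeat split; eexists; eassumption.
- change (fun x : R => k x) with k; change (fun x : R => w x) with w.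
  rewrite (is_derive_unique _ _ _ Hk), (is_derive_unique _ _ _ Hw).
  unfold Ess_ds; field.
Qed.

Lemma is_derive_Ess_v (s v : R) : is_derive (fun t => Ess s t) v (Ess_dv s v).
Proof. unfold Ess, Ess_dv; auto_derive; [trivial | ring]. Qed.

(** The coordinate vectors are X_s = (1 + v k) T + v tau B and X_v = N, so orthonormality of the
    frame yields a diagonal metric. *)
Lemma induced_metric_ruled (i j : coord) (s v : R) :
  J s -> induced_metric (ruled gamma N) i j s v
         = match i, j with cs, cs => Ess s v | cv, cv => 1 | _, _ => 0 end.
Proof.
intros Hs; unfold induced_metric.
pose proof (fc_TT _ _ _ _ _ _ _ _ _ _ frenet s Hs) as HTT.
pose proof (fc_NN _ _ _ _ _ _ _ _ _ _ frenet s Hs) as HNN.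
pose proof (fc_BB _ _ _ _ _ _ _ _ _ _ frenet s Hs) as HBB.
pose proof (fc_TN _ _ _ _ _ _ _ _ _ _ frenet s Hs) as HTN.
pose proof (fc_TB _ _ _ _ _ _ _ _ _ _ frenet s Hs) as HTB.
pose proof (fc_NB _ _ _ _ _ _ _ _ _ _ frenet s Hs) as HNB.
assert (HNT := mink_sym (N s) (T s)).
assert (HBT := mink_sym (B s) (T s)).
assert (HBN := mink_sym (B s) (N s)).
rewrite HTN in HNT; rewrite HTB in HBT; rewrite HNB in HBN.
destruct i, j; rewrite ?dX_ruled_cs, ?dX_ruled_cv by exact Hs; unfold Nprime;
  repeat (rewrite mink_plus_l || rewrite mink_plus_r
          || rewrite mink_scal_l || rewrite mink_scal_r);
  rewrite ?HTT, ?HNN, ?HBB, ?HTN, ?HTB, ?HNB, ?HNT, ?HBT, ?HBN; [| ring ..].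
rewrite Ess_frenet by exact Hs; ring.
Qed.

Lemma inner_ruled (s v : R) (x y : tvec) :
  J s -> inner (induced_metric (ruled gamma N)) s v x y = Ess s v * x cs * y cs + x cv * y cv.
Proof.
intros Hs; unfold inner, sumc; rewrite !induced_metric_ruled by exact Hs; ring.
Qed.

(** The Christoffel symbols of E ds^2 + dv^2: E_s/(2E), - E_v/2 and E_v/(2E). *)
Definition ruled_connection : connection := fun i j l s v =>
  match i, j, l with
  | cs, cs, cs => Ess_ds s v / (2 * Ess s v)
  | cs, cs, cv => - Ess_dv s v / 2
  | cs, cv, cs | cv, cs, cs => Ess_dv s v / (2 * Ess s v)
  | _, _, _ => 0
  end.

Variable delta : R.
Hypothesis Ess_neg : forall s v, strip J delta s v -> Ess s v < 0.

(** Pairing a vanishing image with X_s and X_v turns injectivity into nondegeneracy of the diagonal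
    Gram matrix. *)
Lemma ruled_immersion : immersion (strip J delta) (ruled gamma N).
Proof.
intros s v HD x Hx.
assert (Hs : J s) by apply HD.
assert (H : forall i, mink (push (ruled gamma N) (s, v) x) (dX (ruled gamma N) i s v) = 0).
{ intros i; rewrite Hx; apply mink_zero_l. }
unfold push in H; simpl fst in H; simpl snd in H.
assert (Hm : forall i,
  x cs * induced_metric (ruled gamma N) cs i s v
  + x cv * induced_metric (ruled gamma N) cv i s v = 0).
{ intros i; specialize (H i); now rewrite mink_plus_l, !mink_scal_l in H. }
pose proof (Ess_neg s v HD) as HE.
pose proof (Hm cs) as Hcs; pose proof (Hm cv) as Hcv.
rewrite !induced_metric_ruled in Hcs, Hcv by exact Hs.
intros [].
- apply Rmult_eq_reg_r with (Ess s v); lra.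
- lra.
Qed.

Lemma ruled_lorentz : lorentz (strip J delta) (induced_metric (ruled gamma N)).
Proof.
intros s v HD.
assert (Hs : J s) by apply HD.
pose proof (Ess_neg s v HD) as HE.
split; [| split].
- intros x Hx i.
  pose proof (Hx (coord_field cs s v)) as Hcs; pose proof (Hx (coord_field cv s v)) as Hcv.
  rewrite inner_ruled in Hcs, Hcv by exact Hs; simpl in Hcs, Hcv.
  destruct i; [| lra].
  apply Rmult_eq_reg_l with (Ess s v); lra.
- exists (coord_field cs s v); rewrite inner_ruled by exact Hs; simpl; lra.
- intros H; specialize (H (coord_field cv s v)).
  rewrite inner_ruled in H by exact Hs; simpl in H.
  enough (Ess s v * 0 * 0 + 1 * 1 < 0) by lra.
  apply H; exists cv; lra.
Qed.

Lemma ruled_levi_civita :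
  levi_civita (strip J delta) (induced_metric (ruled gamma N)) ruled_connection.
Proof.
intros s v HD.
assert (Hs : J s) by apply HD.
pose proof (Ess_neg s v HD) as HE.
split.
- intros i j l.
  (* Coordinate fields have constant components; writing them as constant functions makes
     [nabla_constant] and [bracket_constant] applicable. *)
  change (coord_field i) with (fun _ _ : R => coord_field i s v).
  change (coord_field j) with (fun _ _ : R => coord_field j s v).
  rewrite !nabla_constant, bracket_constant.
  unfold sumc; destruct i, j, l; simpl; ring.
- intros i j l.
  rewrite !inner_ruled by exact Hs.
  change (nabla ruled_connection (coord_field i) (coord_field j))
    with (nabla ruled_connection (fun _ _ => coord_field i s v) (fun _ _ => coord_field j s v)).
  change (nabla ruled_connection (coord_field i) (coord_field l))
    with (nabla ruled_connection (fun _ _ => coord_field i s v) (fun _ _ => coord_field l s v)).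
  rewrite !nabla_constant.
  replace (pd i _ s v)
    with (match j, l with
          | cs, cs => match i with cs => Ess_ds s v | cv => Ess_dv s v end
          | _, _ => 0 end).
  + unfold sumc; destruct i, j, l; simpl; field; lra.
  + symmetry; destruct i; simpl.
    (* The metric formula is only known over [J], so differentiating in s uses that [J] is open. In
       the v direction it holds for all values of v. *)
    * rewrite (Derive_ext_loc _ (fun t => match j, l with
        | cs, cs => Ess t v | cv, cv => 1 | _, _ => 0 end)).
      -- destruct j, l; try apply Derive_const.
         now apply is_derive_unique, is_derive_Ess_s.
      -- apply filter_imp with (2 := J_open s Hs); intros t Ht.
         rewrite inner_ruled by exact Ht; destruct j, l; simpl; ring.
    * rewrite (Derive_ext _ (fun t => match j, l with
        | cs, cs => Ess s t | cv, cv => 1 | _, _ => 0 end)).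
      -- destruct j, l; try apply Derive_const.
         apply is_derive_unique, is_derive_Ess_v.
      -- intros t; rewrite inner_ruled by exact Hs; destruct j, l; simpl; ring.
Qed.


(** On v = 0 one has E = -1, E_s = 0 and E_v = - 2 k. *)
Lemma ruled_connection_base (i j l : coord) (s : R) :
  ruled_connection i j l s 0
  = match i, j, l with
    | cs, cs, cv | cs, cv, cs | cv, cs, cs => k s
    | _, _, _ => 0
    end.
Proof.
assert (HE : Ess s 0 = -1) by (unfold Ess; ring).
assert (HEs : Ess_ds s 0 = 0) by (unfold Ess_ds; ring).
assert (HEv : Ess_dv s 0 = - 2 * k s) by (unfold Ess_dv; ring).
destruct i, j, l; unfold ruled_connection; rewrite ?HE, ?HEs, ?HEv; field.
Qed.

(** For a field a T + b N along the curve the components become a' + k b and b' + k a. Both signs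
    are positive because T is timelike and N spacelike. *)
Lemma cov_along_base (V : R -> tvec) (a b : R -> R) (s da db : R) :
  J s -> (forall t, J t -> V t cs = a t /\ V t cv = b t) ->
  is_derive a s da -> is_derive b s db ->
  cov_along ruled_connection base_curve V s cs = da + k s * b s /\
  cov_along ruled_connection base_curve V s cv = db + k s * a s.
Proof.
intros Hs HV Ha Hb.
assert (Da : Derive (fun t => V t cs) s = da).
{ rewrite (Derive_ext_loc _ a); [now apply is_derive_unique |].
  apply filter_imp with (2 := J_open s Hs); intros t Ht; now apply HV. }
assert (Db : Derive (fun t => V t cv) s = db).
{ rewrite (Derive_ext_loc _ b); [now apply is_derive_unique |].
  apply filter_imp with (2 := J_open s Hs); intros t Ht; now apply HV. }
unfold cov_along, sumc, base_curve, velocity; simpl fst; simpl snd.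
rewrite Da, Db, !ruled_connection_base, Derive_id, Derive_const.
destruct (HV s Hs) as [-> ->]; split; ring.
Qed.

Lemma velocity_base (s : R) (i : coord) :
  velocity base_curve s i = coord_field cs s 0 i.
Proof.
unfold velocity, base_curve; simpl.
destruct i; [apply Derive_id | apply Derive_const].
Qed.

Ltac derive_kw s Hs :=
  pose proof (k_derive s Hs) as Hk; pose proof (w_derive s Hs) as Hw;
  auto_derive;
  [ repeat split; eexists; eassumption
  | change (fun x : R => k x) with k; change (fun x : R => w x) with w;
    rewrite ?(is_derive_unique _ _ _ Hk), ?(is_derive_unique _ _ _ Hw) ].

(** Here [a'] and [b'] are the components of the next iterate rather than derivatives. Stating the
    derivatives in terms of them lets each of the following steps announce its result and check it
    by differentiation. *)
Lemma cov_iter_base (n : nat) (a b a' b' : R -> R) :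
  (forall s, J s -> cov_iter ruled_connection base_curve n s cs = a s /\
                    cov_iter ruled_connection base_curve n s cv = b s) ->
  (forall s, J s -> is_derive a s (a' s - k s * b s)) ->
  (forall s, J s -> is_derive b s (b' s - k s * a s)) ->
  forall s, J s -> cov_iter ruled_connection base_curve (S n) s cs = a' s /\
                   cov_iter ruled_connection base_curve (S n) s cv = b' s.
Proof.
intros Hn Ha Hb s Hs.
destruct (cov_along_base (cov_iter ruled_connection base_curve n) a b s _ _ Hs Hn
  (Ha s Hs) (Hb s Hs)) as [Hcs Hcv].
change (cov_iter ruled_connection base_curve (S n))
  with (cov_along ruled_connection base_curve (cov_iter ruled_connection base_curve n)).
rewrite Hcs, Hcv; split; ring.
Qed.

Lemma cov_iter_base_0 (s : R) :
  J s -> cov_iter ruled_connection base_curve 0 s cs = 1 /\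
         cov_iter ruled_connection base_curve 0 s cv = 0.
Proof.
intros Hs; change (cov_iter ruled_connection base_curve 0) with (velocity base_curve).
now rewrite !velocity_base.
Qed.

Lemma cov_iter_base_1 (s : R) :
  J s -> cov_iter ruled_connection base_curve 1 s cs = 0 /\
         cov_iter ruled_connection base_curve 1 s cv = k s.
Proof.
revert s.
apply (cov_iter_base 0 (fun _ => 1) (fun _ => 0) (fun _ => 0) k cov_iter_base_0);
  intros s Hs; derive_kw s Hs; ring.
Qed.

Lemma cov_iter_base_2 (s : R) :
  J s -> cov_iter ruled_connection base_curve 2 s cs = k s ^ 2 /\
         cov_iter ruled_connection base_curve 2 s cv = k s * w s.
Proof.
revert s.
apply (cov_iter_base 1 (fun _ => 0) k (fun s => k s ^ 2) (fun s => k s * w s)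
  cov_iter_base_1); intros s Hs; derive_kw s Hs; ring.
Qed.

Lemma cov_iter_base_3 (s : R) :
  J s -> cov_iter ruled_connection base_curve 3 s cs = 3 * k s ^ 2 * w s /\
         cov_iter ruled_connection base_curve 3 s cv = 3 / 5 * k s ^ 3.
Proof.
revert s.
apply (cov_iter_base 2 _ _ (fun s => 3 * k s ^ 2 * w s) (fun s => 3 / 5 * k s ^ 3)
  cov_iter_base_2); intros s Hs; derive_kw s Hs; field.
Qed.

Lemma cov_iter_base_4 (s : R) :
  J s -> cov_iter ruled_connection base_curve 4 s cs
         = 3 * k s ^ 2 * w s ^ 2 - 3 / 5 * k s ^ 4 /\
         cov_iter ruled_connection base_curve 4 s cv = 24 / 5 * k s ^ 3 * w s.
Proof.
revert s.
apply (cov_iter_base 3 _ _ (fun s => 3 * k s ^ 2 * w s ^ 2 - 3 / 5 * k s ^ 4)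
  (fun s => 24 / 5 * k s ^ 3 * w s) cov_iter_base_3); intros s Hs; derive_kw s Hs; field.
Qed.

(** The tangential component cancels thanks to the equation for w', which was chosen for this
    purpose. *)
Lemma cov_iter_base_5 (s : R) :
  J s -> cov_iter ruled_connection base_curve 5 s cs = 0 /\
         cov_iter ruled_connection base_curve 5 s cv
         = 63 / 5 * k s ^ 3 * w s ^ 2 - 63 / 25 * k s ^ 5.
Proof.
revert s.
apply (cov_iter_base 4 _ _ (fun _ => 0)
  (fun s => 63 / 5 * k s ^ 3 * w s ^ 2 - 63 / 25 * k s ^ 5) cov_iter_base_4);
  intros s Hs; derive_kw s Hs; field.
Qed.

(** * The curvature operator along the base curve *)

Lemma nabla_base_cs (x : tvec) (s : R) (Y : vfield) (l : coord) (ds dv : R) :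
  is_derive (fun t : R => Y t 0 l) s ds -> is_derive (fun t : R => Y s t l) 0 dv ->
  nabla ruled_connection (fun _ _ => x) Y s 0 l
  = x cs * ds + x cv * dv
    + match l with
      | cs => k s * (x cs * Y s 0 cv + x cv * Y s 0 cs)
      | cv => k s * (x cs * Y s 0 cs)
      end.
Proof.
intros Hds Hdv; unfold nabla, sumc, pd.
rewrite !ruled_connection_base.
rewrite (is_derive_unique _ _ _ Hds), (is_derive_unique _ _ _ Hdv).
destruct l; ring.
Qed.

Lemma nabla_tangent (y z : tvec) (s v : R) (l : coord) :
  z cs = 1 -> z cv = 0 ->
  nabla ruled_connection (fun _ _ => y) (fun _ _ => z) s v l
  = match l with
    | cs => (y cs * Ess_ds s v + y cv * Ess_dv s v) / (2 * Ess s v)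
    | cv => - y cs * Ess_dv s v / 2
    end.
Proof.
intros H1 H0; rewrite nabla_constant; unfold sumc; rewrite H1, H0.
destruct l; simpl; unfold Rdiv; ring.
Qed.

(** The inner covariant derivative must be known off the base curve, since it is differentiated in
    v. The torsion enters there: on v = 0, E_vv = 2 (tau^2 - k^2) and the v-derivative of E_v/(2E)
    is - (tau^2 + k^2). *)
Lemma nabla_nabla_tangent (x y z : tvec) (s : R) (l : coord) :
  J s -> z cs = 1 -> z cv = 0 ->
  nabla ruled_connection (fun _ _ => x)
    (nabla ruled_connection (fun _ _ => y) (fun _ _ => z)) s 0 l
  = match l with
    | cs => (x cs * y cv + x cv * y cs) * (k s * w s) + x cs * y cs * k s ^ 2
            - x cv * y cv * tau s ^ 2
    | cv => x cs * y cs * (k s * w s) + x cs * y cv * k s ^ 2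
            - x cv * y cs * (tau s ^ 2 - k s ^ 2)
    end.
Proof.
intros Hs H1 H0.
rewrite (nabla_base_cs x s _ l
  (match l with cs => y cv | cv => y cs end * (k s * w s))
  (match l with
   | cs => y cs * (k s * w s) - y cv * (tau s ^ 2 + k s ^ 2)
   | cv => - y cs * (tau s ^ 2 - k s ^ 2) end)).
- rewrite !nabla_tangent by assumption.
  unfold Ess, Ess_ds, Ess_dv; destruct l; field; lra.
- apply (is_derive_ext (fun t => match l with cs => y cv * k t | cv => y cs * k t end)).
  + intros t; rewrite nabla_tangent by assumption.
    match goal with |- ?u = ?v => change (@eq R u v) end.
    unfold Ess, Ess_ds, Ess_dv; destruct l; field; lra.
  + destruct l; derive_kw s Hs; ring.
- apply (is_derive_ext (fun t => match l with
    | cs => (y cs * Ess_ds s t + y cv * Ess_dv s t) / (2 * Ess s t)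
    | cv => - y cs * Ess_dv s t / 2 end)).
  + intros t; now rewrite nabla_tangent by assumption.
  + rewrite tau_sqr by exact Hs.
    unfold Ess, Ess_ds, Ess_dv; destruct l; auto_derive; try (trivial; lra); field; lra.
Qed.

(** Constant fields commute, so only the antisymmetric part in [x] and [y] of the second derivative
    remains. The terms in k w are symmetric and those in k^2 cancel. *)
Lemma curvature_at_base (x y z : tvec) (s : R) (l : coord) :
  J s -> z cs = 1 -> z cv = 0 ->
  curvature_at ruled_connection (base_curve s) x y z l
  = match l with
    | cs => 0
    | cv => - tau s ^ 2 * (x cv * y cs - x cs * y cv)
    end.
Proof.
intros Hs H1 H0; unfold curvature_at, curvature_operator, base_curve; simpl fst; simpl snd.
rewrite !nabla_nabla_tangent by assumption.
unfold nabla at 1, sumc at 1; rewrite !bracket_constant.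
destruct l; ring.
Qed.

Lemma base_curve_triharmonic : triharmonic J ruled_connection base_curve.
Proof.
intros s Hs i.
destruct (cov_iter_base_0 s Hs) as [V0s V0v]; destruct (cov_iter_base_1 s Hs) as [V1s V1v].
destruct (cov_iter_base_2 s Hs) as [V2s V2v]; destruct (cov_iter_base_3 s Hs) as [V3s V3v].
destruct (cov_iter_base_5 s Hs) as [V5s V5v].
rewrite !curvature_at_base by assumption.
destruct i; rewrite ?V0s, ?V0v, ?V1s, ?V1v, ?V2s, ?V2v, ?V3s, ?V3v, ?V5s, ?V5v.
- ring.
(* The two curvature terms contribute - (3/5) tau^2 k^3 and - tau^2 k^3, so the normal component is
   k^3 ((63/5) (w^2 - k^2/5) - (8/5) tau^2). This is the origin of the factor 63/8. *)
- rewrite tau_sqr by exact Hs; field.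
Qed.

Lemma base_curve_not_geodesic (s : R) :
  J s -> k s <> 0 -> ~ geodesic J ruled_connection base_curve.
Proof.
intros Hs Hk Hgeo; apply Hk.
destruct (cov_iter_base_1 s Hs) as [_ <-]; exact (Hgeo s Hs cv).
Qed.

Lemma base_curve_frenet_in_surface :
  frenet_in_surface J (ruled gamma N) ruled_connection (-1) 1 base_curve N k.
Proof.
(* Since X_v = N, the normal of the curve is the second coordinate vector. *)
exists (fun s => coord_field cv s 0); intros s Hs; split; [| split].
- unfold push, base_curve; simpl fst; simpl snd; rewrite dX_ruled_cv; simpl.
  change (plus (scal 0 (dX (ruled gamma N) cs s 0)) (scal 1 (N s)) = N s).
  rewrite (scal_zero_l (V := R3_module)), (scal_one (V := R3_module)).
  apply (plus_zero_l (G := R3_module)).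
- destruct (cov_iter_base_1 s Hs) as [V1s V1v]; intros [].
  + change (cov_iter ruled_connection base_curve 1 s cs = 1 * k s * 0); rewrite V1s; ring.
  + change (cov_iter ruled_connection base_curve 1 s cv = 1 * k s * 1); rewrite V1v; ring.
- assert (H := cov_along_base (fun s => coord_field cv s 0) (fun _ => 0) (fun _ => 1) s 0 0 Hs
    (fun _ _ => conj eq_refl eq_refl)
    (is_derive_const (K := R_AbsRing) (V := R_NormedModule) 0 s)
    (is_derive_const (K := R_AbsRing) (V := R_NormedModule) 1 s)).
  destruct H as [Hcs Hcv]; intros i; rewrite velocity_base.
  destruct i; [rewrite Hcs | rewrite Hcv]; simpl; ring.
Qed.

(** A constant k would have derivative zero at [s], whereas that derivative is k w. *)
Lemma base_curve_non_constant (s : R) : J s -> k s <> 0 -> w s <> 0 -> non_constant J k.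
Proof.
intros Hs Hk Hw; apply NNPP; intros Hc.
enough (k s * w s = 0) by (apply Rmult_integral in H; tauto).
rewrite <- (is_derive_unique _ _ _ (k_derive s Hs)).
rewrite (Derive_ext_loc _ (fun _ => k s)); [apply Derive_const |].
apply filter_imp with (2 := J_open s Hs); intros t Ht.
apply NNPP; intros Hne; apply Hc; now exists t, s.
Qed.

End RuledSurface.

(** * The curve *)

Lemma is_derive_R3 (f1 f2 f3 : R -> R) (s : R) (l : R3) :
  is_derive f1 s (x1 l) -> is_derive f2 s (x2 l) -> is_derive f3 s (x3 l) ->
  is_derive (V := R3_module) (fun t => (f1 t, f2 t, f3 t)) s l.
Proof.
intros H1 H2 H3; rewrite <- (surjective_R3 l).
apply (is_derive_pair (U := prod_NormedModule R_AbsRing R_NormedModule R_NormedModule)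
  (V := R_NormedModule)); [| exact H3].
now apply (is_derive_pair (U := R_NormedModule) (V := R_NormedModule)).
Qed.

Lemma derive_zero_constant (f : R -> R) (rho s : R) :
  (forall t, Rabs t < rho -> is_derive f t 0) -> Rabs s < rho -> f s = f 0.
Proof.
intros Hf Hs.
destruct (Rtotal_order 0 s) as [H | [<- | H]]; [symmetry | reflexivity |].
- apply (eq_is_derive (V := R_NormedModule) f 0 s); trivial.
  intros t Ht; apply Hf; rewrite Rabs_pos_eq in * by lra; lra.
- apply (eq_is_derive (V := R_NormedModule) f s 0); trivial.
  intros t Ht; apply Hf; rewrite Rabs_left1 in * by lra; lra.
Qed.

Lemma locally_Rabs_lt (f : R -> R) (x M : R) :
  ex_derive f x -> Rabs (f x) < M -> locally x (fun t => Rabs (f t) < M).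
Proof.
intros Hf HM.
pose proof (ex_derive_continuous f x Hf) as Hc.
assert (Hp : 0 < M - Rabs (f x)) by lra.
generalize (proj1 (filterlim_locally f (f x)) Hc (mkposreal _ Hp)).
apply filter_imp; intros t Ht.
change (Rabs (f t - f x) < M - Rabs (f x)) in Ht.
pose proof (Rabs_triang_inv (f t) (f x)); lra.
Qed.

(** Cramer's rule: combining the three equations with cofactors isolates each unknown times the
    determinant. *)
Lemma determinant_kernel (t1 t2 t3 n1 n2 n3 b1 b2 b3 p q r : R) :
  t1 * (n2 * b3 - n3 * b2) - t2 * (n1 * b3 - n3 * b1) + t3 * (n1 * b2 - n2 * b1) <> 0 ->
  p * t1 + q * n1 + r * b1 = 0 ->
  p * t2 + q * n2 + r * b2 = 0 ->
  p * t3 + q * n3 + r * b3 = 0 ->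
  p = 0 /\ q = 0 /\ r = 0.
Proof.
set (d := _ - _ + _); intros Hd E1 E2 E3.
assert (Hp : p * d = (p * t1 + q * n1 + r * b1) * (n2 * b3 - n3 * b2)
  - (p * t2 + q * n2 + r * b2) * (n1 * b3 - n3 * b1)
  + (p * t3 + q * n3 + r * b3) * (n1 * b2 - n2 * b1)) by (unfold d; ring).
assert (Hq : q * d = - (p * t1 + q * n1 + r * b1) * (t2 * b3 - t3 * b2)
  + (p * t2 + q * n2 + r * b2) * (t1 * b3 - t3 * b1)
  - (p * t3 + q * n3 + r * b3) * (t1 * b2 - t2 * b1)) by (unfold d; ring).
assert (Hr : r * d = (p * t1 + q * n1 + r * b1) * (t2 * n3 - t3 * n2)
  - (p * t2 + q * n2 + r * b2) * (t1 * n3 - t3 * n1)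
  + (p * t3 + q * n3 + r * b3) * (t1 * n2 - t2 * n1)) by (unfold d; ring).
rewrite E1, E2, E3 in Hp, Hq, Hr.
repeat split; apply (Rmult_eq_reg_r d); trivial; lra.
Qed.

(** A one-sided inverse of a square matrix is two-sided: [M^t eps M = eps] gives
    [M eps M^t = eps] for the matrix [M] with rows [T], [N], [B]. *)
Lemma lorentz_matrix_rows (T N B : R3) :
  - x1 T * x1 T + x1 N * x1 N + x1 B * x1 B = -1 ->
  - x1 T * x2 T + x1 N * x2 N + x1 B * x2 B = 0 ->
  - x1 T * x3 T + x1 N * x3 N + x1 B * x3 B = 0 ->
  - x2 T * x2 T + x2 N * x2 N + x2 B * x2 B = 1 ->
  - x2 T * x3 T + x2 N * x3 N + x2 B * x3 B = 0 ->
  - x3 T * x3 T + x3 N * x3 N + x3 B * x3 B = 1 ->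
  mink T T = -1 /\ mink N N = 1 /\ mink B B = 1 /\
  mink T N = 0 /\ mink T B = 0 /\ mink N B = 0.
Proof.
destruct T as [[t1 t2] t3], N as [[n1 n2] n3], B as [[b1 b2] b3].
unfold mink, x1, x2, x3; simpl; intros E11 E12 E13 E22 E23 E33.
set (d := t1 * (n2 * b3 - n3 * b2) - t2 * (n1 * b3 - n3 * b1) + t3 * (n1 * b2 - n2 * b1)).
assert (Hd : d <> 0).
(* Taking determinants in M^t eps M = eps gives - d^2 = -1. *)
{ assert (H : - d ^ 2 = (-1) * (1 * 1 - 0 * 0) - 0 * (0 * 1 - 0 * 0) + 0 * (0 * 0 - 1 * 0)).
  { assert (Hdet : - d ^ 2
      = (- t1 * t1 + n1 * n1 + b1 * b1)
        * ((- t2 * t2 + n2 * n2 + b2 * b2) * (- t3 * t3 + n3 * n3 + b3 * b3)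
           - (- t2 * t3 + n2 * n3 + b2 * b3) ^ 2)
        - (- t1 * t2 + n1 * n2 + b1 * b2)
          * ((- t1 * t2 + n1 * n2 + b1 * b2) * (- t3 * t3 + n3 * n3 + b3 * b3)
             - (- t2 * t3 + n2 * n3 + b2 * b3) * (- t1 * t3 + n1 * n3 + b1 * b3))
        + (- t1 * t3 + n1 * n3 + b1 * b3)
          * ((- t1 * t2 + n1 * n2 + b1 * b2) * (- t2 * t3 + n2 * n3 + b2 * b3)
             - (- t2 * t2 + n2 * n2 + b2 * b2) * (- t1 * t3 + n1 * n3 + b1 * b3)))
      by (unfold d; ring).
    rewrite Hdet, E11, E12, E13, E22, E23, E33; ring. }
  intros H0; rewrite H0 in H; lra. }
(* The column relations say that v = - <v,T> T + <v,N> N + <v,B> B for every v. By independence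
   these coefficients agree with any expansion of v in the frame; it remains to apply this to T, N
   and B. *)
assert (Hrow : forall v1 v2 v3 c1 c2 c3,
  v1 = c1 * t1 + c2 * n1 + c3 * b1 ->
  v2 = c1 * t2 + c2 * n2 + c3 * b2 ->
  v3 = c1 * t3 + c2 * n3 + c3 * b3 ->
  - v1 * t1 + v2 * t2 + v3 * t3 = - c1 /\
  - v1 * n1 + v2 * n2 + v3 * n3 = c2 /\
  - v1 * b1 + v2 * b2 + v3 * b3 = c3).
{ intros v1 v2 v3 c1 c2 c3 V1 V2 V3.
  set (mt := - v1 * t1 + v2 * t2 + v3 * t3).
  set (mn := - v1 * n1 + v2 * n2 + v3 * n3).
  set (mb := - v1 * b1 + v2 * b2 + v3 * b3).
  destruct (determinant_kernel t1 t2 t3 n1 n2 n3 b1 b2 b3 (- mt - c1) (mn - c2) (mb - c3) Hd)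
    as (H1 & H2 & H3); [| | | lra].
  - transitivity (- v1 * (- t1 * t1 + n1 * n1 + b1 * b1)
      + v2 * (- t1 * t2 + n1 * n2 + b1 * b2) + v3 * (- t1 * t3 + n1 * n3 + b1 * b3)
      - (c1 * t1 + c2 * n1 + c3 * b1)); [unfold mt, mn, mb; ring |].
    rewrite E11, E12, E13, <- V1; ring.
  - transitivity (- v1 * (- t1 * t2 + n1 * n2 + b1 * b2)
      + v2 * (- t2 * t2 + n2 * n2 + b2 * b2) + v3 * (- t2 * t3 + n2 * n3 + b2 * b3)
      - (c1 * t2 + c2 * n2 + c3 * b2)); [unfold mt, mn, mb; ring |].
    rewrite E12, E22, E23, <- V2; ring.
  - transitivity (- v1 * (- t1 * t3 + n1 * n3 + b1 * b3)
      + v2 * (- t2 * t3 + n2 * n3 + b2 * b3) + v3 * (- t3 * t3 + n3 * n3 + b3 * b3)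
      - (c1 * t3 + c2 * n3 + c3 * b3)); [unfold mt, mn, mb; ring |].
    rewrite E13, E23, E33, <- V3; ring. }
destruct (Hrow t1 t2 t3 1 0 0) as (TT & TN & TB); [ring .. |].
destruct (Hrow n1 n2 n3 0 1 0) as (NT & NN & NB); [ring .. |].
destruct (Hrow b1 b2 b3 0 0 1) as (BT & BN & BB); [ring .. |].
repeat split; lra.
Qed.

(** * The polynomial system for the curve and its frame *)

Inductive axis : Set := ax1 | ax2 | ax3.

Inductive unknown : Set :=
| Urho | Uc | Uh
| Ugamma (i : axis) | UT (i : axis) | UN (i : axis) | UB (i : axis).

Definition unknowns : list unknown :=
  Urho :: Uc :: Uh :: flat_map (fun i => Ugamma i :: UT i :: UN i :: UB i :: nil)
                               (ax1 :: ax2 :: ax3 :: nil).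

Lemma unknowns_complete (i : unknown) : In i unknowns.
Proof. destruct i as [| | | [] | [] | [] | []]; simpl; tauto. Qed.

Definition torsion_factor : R := sqrt (63 / 8).

(** The frame starts at the standard basis. The values 3/2 and 5/2 satisfy c^2 - h^2/5 = 9/4 - 5/4 =
    1 and make both k and k' nonzero at 0. *)
Definition initial_value (i : unknown) : R :=
  match i with
  | Urho => 1
  | Uc => 3 / 2
  | Uh => 5 / 2
  | UT ax1 | UN ax2 | UB ax3 => 1
  | _ => 0
  end.

(** With [k = rho h], [w = k' / k = rho c] and [tau = sqrt (63/8) rho], the
    triharmonicity relation [tau^2 = (63/8) (w^2 - k^2/5)] becomes the first
    integral [c^2 - h^2/5 = 1] of a polynomial system. *)
Definition curve_system (i : unknown) : pexpr unknown :=
  let rho := PVar Urho in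
  let c := PVar Uc in
  let h := PVar Uh in
  let k := PMul rho h in
  let tau := PMul (PCst torsion_factor) rho in
  let g := PAdd (PCst 1) (PMul (PCst (2 / 5)) (PMul h h)) in
  match i with
  | Urho => PMul (PMul (PMul (PCst (-1)) rho) (PMul rho c))
                (PAdd (PCst 1) (PMul (PCst (4 / 5)) (PMul h h)))
  | Uc => PMul (PMul (PMul (PCst (2 / 5)) rho) (PMul h h)) g
  | Uh => PMul (PMul (PMul (PCst 2) rho) (PMul h c)) g
  | Ugamma i => PVar (UT i)
  | UT i => PMul k (PVar (UN i))
  | UN i => PAdd (PMul k (PVar (UT i))) (PMul tau (PVar (UB i)))
  | UB i => PMul (PMul (PCst (-1)) tau) (PVar (UN i))
  end.

Definition frame_vector (V : axis -> unknown) (y : unknown -> R -> R) (s : R) : R3 :=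
  (y (V ax1) s, y (V ax2) s, y (V ax3) s).

(** * From a solution of the system to a Frenet curve with the required curvature and torsion *)

Section Solution.

Variables (y : unknown -> R -> R) (rho : R).
Hypothesis y_init : forall i, y i 0 = initial_value i.
Hypothesis y_smooth : forall i n s, Rabs s < rho -> ex_derive_n (y i) n s.
Hypothesis y_derive : forall i s, Rabs s < rho ->
  is_derive (y i) s (peval (fun j => y j s) (curve_system i)).

Definition sol_k (s : R) : R := y Urho s * y Uh s.
Definition sol_w (s : R) : R := y Urho s * y Uc s.
Definition sol_tau (s : R) : R := torsion_factor * y Urho s.

(** The system satisfies c c' = h h'/5, so c^2 - h^2/5 keeps its initial value 1. *)
Lemma first_integral (s : R) : Rabs s < rho -> y Uc s ^ 2 = 1 + y Uh s ^ 2 / 5.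
Proof.
intros Hs.
enough (H : y Uc s * y Uc s - y Uh s * y Uh s / 5 = 1) by (simpl; lra).
transitivity (y Uc 0 * y Uc 0 - y Uh 0 * y Uh 0 / 5).
- apply (derive_zero_constant (fun s => y Uc s * y Uc s - y Uh s * y Uh s / 5) rho); trivial.
  intros t Ht.
  pose proof (y_derive Uc t Ht) as Hc; pose proof (y_derive Uh t Ht) as Hh.
  auto_derive.
  + repeat split; eexists; eassumption.
  + change (fun x : R => y Uc x) with (y Uc); change (fun x : R => y Uh x) with (y Uh).
    rewrite (is_derive_unique _ _ _ Hc), (is_derive_unique _ _ _ Hh); simpl; field.
- rewrite !y_init; simpl; field.
Qed.

Lemma sol_k_derive (s : R) : Rabs s < rho -> is_derive sol_k s (sol_k s * sol_w s).
Proof.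
intros Hs; unfold sol_k.
pose proof (y_derive Urho s Hs) as Hr; pose proof (y_derive Uh s Hs) as Hh.
auto_derive.
- repeat split; eexists; eassumption.
- change (fun x : R => y Urho x) with (y Urho); change (fun x : R => y Uh x) with (y Uh).
  rewrite (is_derive_unique _ _ _ Hr), (is_derive_unique _ _ _ Hh); unfold sol_w; simpl; field.
Qed.

Lemma sol_w_derive (s : R) :
  Rabs s < rho -> is_derive sol_w s (- sol_w s ^ 2 - 2 / 5 * sol_k s ^ 2).
Proof.
intros Hs; unfold sol_w.
pose proof (y_derive Urho s Hs) as Hr; pose proof (y_derive Uc s Hs) as Hc.
auto_derive.
- repeat split; eexists; eassumption.
- change (fun x : R => y Urho x) with (y Urho); change (fun x : R => y Uc x) with (y Uc).
  rewrite (is_derive_unique _ _ _ Hr), (is_derive_unique _ _ _ Hc).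
  apply Rminus_diag_uniq.
  (* The equation for w' holds only modulo the first integral; this multiple of it is the exact
     defect. *)
  transitivity (- (4 / 5) * sol_k s ^ 2 * (y Uc s ^ 2 - (1 + y Uh s ^ 2 / 5))).
  + unfold sol_k; simpl; field.
  + rewrite first_integral by exact Hs; ring.
Qed.

Lemma sol_tau_sqr (s : R) :
  Rabs s < rho -> sol_tau s ^ 2 = 63 / 8 * (sol_w s ^ 2 - sol_k s ^ 2 / 5).
Proof.
intros Hs; unfold sol_tau, sol_w, sol_k, torsion_factor.
rewrite !Rpow_mult_distr, pow2_sqrt, first_integral by (exact Hs || lra); field.
Qed.

(** Products of columns, unlike products of frame vectors, have a derivative that vanishes
    identically by the Frenet equations. They are therefore conserved without a uniqueness argument,
    and [lorentz_matrix_rows] then gives orthonormality. *)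
Lemma frame_gram (i j : axis) (s : R) : Rabs s < rho ->
  - y (UT i) s * y (UT j) s + y (UN i) s * y (UN j) s + y (UB i) s * y (UB j) s
  = - initial_value (UT i) * initial_value (UT j)
    + initial_value (UN i) * initial_value (UN j)
    + initial_value (UB i) * initial_value (UB j).
Proof.
intros Hs; rewrite <- !y_init.
apply (derive_zero_constant (fun s =>
  - y (UT i) s * y (UT j) s + y (UN i) s * y (UN j) s + y (UB i) s * y (UB j) s) rho); trivial.
intros t Ht.
pose proof (y_derive (UT i) t Ht) as HTi; pose proof (y_derive (UT j) t Ht) as HTj.
pose proof (y_derive (UN i) t Ht) as HNi; pose proof (y_derive (UN j) t Ht) as HNj.
pose proof (y_derive (UB i) t Ht) as HBi; pose proof (y_derive (UB j) t Ht) as HBj.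
auto_derive.
- repeat split; eexists; eassumption.
- change (fun x : R => y (UT i) x) with (y (UT i)); change (fun x : R => y (UT j) x) with (y (UT j)).
  change (fun x : R => y (UN i) x) with (y (UN i)); change (fun x : R => y (UN j) x) with (y (UN j)).
  change (fun x : R => y (UB i) x) with (y (UB i)); change (fun x : R => y (UB j) x) with (y (UB j)).
  rewrite (is_derive_unique _ _ _ HTi), (is_derive_unique _ _ _ HTj),
    (is_derive_unique _ _ _ HNi), (is_derive_unique _ _ _ HNj),
    (is_derive_unique _ _ _ HBi), (is_derive_unique _ _ _ HBj); simpl; ring.
Qed.

Lemma sol_frenet (J : R -> Prop) :
  (forall s, J s -> Rabs s < rho) ->
  frenet_curve J (-1) 1 1 (frame_vector Ugamma y) (frame_vector UT y)
    (frame_vector UN y) (frame_vector UB y) sol_k sol_tau.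
Proof.
intros HJ.
assert (Hsm : forall V, smooth_on J (frame_vector V y)).
{ intros V n s Hs; apply HJ in Hs; split; [| split]; now apply y_smooth. }
assert (Hon : forall s, J s ->
  let T := frame_vector UT y s in
  let N := frame_vector UN y s in
  let B := frame_vector UB y s in
  mink T T = -1 /\ mink N N = 1 /\ mink B B = 1 /\
  mink T N = 0 /\ mink T B = 0 /\ mink N B = 0).
{ intros s Hs; apply HJ in Hs.
  apply lorentz_matrix_rows; unfold frame_vector, x1, x2, x3; simpl;
    rewrite frame_gram by exact Hs; simpl; ring. }
constructor.
1: now right.
1, 2: now left.
1-4: apply Hsm.
1-6: intros s Hs; apply (Hon s Hs).
- intros s Hs; apply HJ in Hs; apply is_derive_R3.
  + apply (y_derive (Ugamma ax1) s Hs).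
  + apply (y_derive (Ugamma ax2) s Hs).
  + apply (y_derive (Ugamma ax3) s Hs).
- intros s Hs; apply HJ in Hs; rewrite Rmult_1_l; apply is_derive_R3.
  + apply (y_derive (UT ax1) s Hs).
  + apply (y_derive (UT ax2) s Hs).
  + apply (y_derive (UT ax3) s Hs).
- intros s Hs; apply HJ in Hs.
  replace (- -1 * sol_k s) with (sol_k s) by ring; rewrite Rmult_1_l; apply is_derive_R3.
  + apply (y_derive (UN ax1) s Hs).
  + apply (y_derive (UN ax2) s Hs).
  + apply (y_derive (UN ax3) s Hs).
- intros s Hs; apply HJ in Hs; apply is_derive_R3.
  + apply (y_derive (UB ax1) s Hs).
  + apply (y_derive (UB ax2) s Hs).
  + apply (y_derive (UB ax3) s Hs).
Qed.

End Solution.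

Theorem theorem1p11 :
  exists (a b : Rbar) (e1 e2 e3 : R) (gamma T N B : R -> R3)
         (k_gamma tau_gamma : R -> R) (delta : R),
    let J := real_interval a b in
    let X := ruled gamma N in
    let D := strip J delta in
    Rbar_lt a b /\
    e3 = 1 /\
    frenet_curve J e1 e2 e3 gamma T N B k_gamma tau_gamma /\
    0 < delta /\
    immersion D X /\
    lorentz D (induced_metric X) /\
    exists C : connection,
      levi_civita D (induced_metric X) C /\
      proper_triharmonic J C base_curve /\
      exists k : R -> R,
        frenet_in_surface J X C e1 e2 base_curve N k /\
        non_constant J k.
Proof.
destruct (polynomial_ode_solution curve_system initial_value unknowns unknowns_complete)
  as (rho & y & Hrho & y_init & y_smooth & y_derive).
set (k := sol_k y); set (w := sol_w y); set (tau := sol_tau y).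
assert (H0 : Rabs 0 < rho) by now rewrite Rabs_R0.
assert (k0 : k 0 = 5 / 2) by (unfold k, sol_k; rewrite !y_init; simpl; field).
assert (w0 : w 0 = 3 / 2) by (unfold w, sol_w; rewrite !y_init; simpl; field).
(* A strict bound for both |k| and |tau| at 0, hence near 0 by continuity. Such a uniform bound on
   [J] allows one width [delta] for the whole strip. *)
set (M := Rabs (k 0) + Rabs (tau 0) + 1).
assert (HM : 0 < M).
{ unfold M; pose proof (Rabs_pos (k 0)); pose proof (Rabs_pos (tau 0)); lra. }
assert (Hloc : locally 0 (fun s => Rabs s < rho /\ Rabs (k s) < M /\ Rabs (tau s) < M)).
{ repeat apply filter_and; apply locally_Rabs_lt; trivial.
  - apply ex_derive_id.
  - eexists; now apply (sol_k_derive y rho).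
  - unfold M; pose proof (Rabs_pos (tau 0)); lra.
  - unfold tau, sol_tau; apply ex_derive_scal; eexists; now apply y_derive.
  - unfold M; pose proof (Rabs_pos (k 0)); lra. }
destruct Hloc as [[eps Heps] Hloc].
set (J := real_interval (- eps) eps).
assert (HJ : forall s, J s -> Rabs s < rho /\ Rabs (k s) < M /\ Rabs (tau s) < M).
{ intros s [Hs1 Hs2]; simpl in Hs1, Hs2; apply Hloc.
  change (Rabs (s - 0) < eps); rewrite Rminus_0_r; now apply Rabs_def1. }
assert (HJ0 : J 0) by (split; simpl; lra).
assert (HJ_open : forall s, J s -> locally s J).
{ intros s [Hs1 Hs2]; apply filter_and;
    [now apply open_Rbar_gt | now apply open_Rbar_lt]. }
assert (Hfr := sol_frenet y rho y_init y_smooth y_derive J (fun s Hs => proj1 (HJ s Hs))).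
assert (Hk : forall s, J s -> is_derive k s (k s * w s)).
{ intros s Hs; apply (sol_k_derive y rho); trivial; now apply HJ. }
assert (Hw : forall s, J s -> is_derive w s (- w s ^ 2 - 2 / 5 * k s ^ 2)).
{ intros s Hs; apply (sol_w_derive y rho); trivial; now apply HJ. }
assert (Htau : forall s, J s -> tau s ^ 2 = 63 / 8 * (w s ^ 2 - k s ^ 2 / 5)).
{ intros s Hs; apply (sol_tau_sqr y rho); trivial; now apply HJ. }
set (delta := / (4 * M)).
assert (Hdelta : 0 < delta) by (apply Rinv_0_lt_compat; lra).
(* With delta = 1/(4M), both v k and v tau lie in (-1/4, 1/4), so (1 + v k)^2 > 9/16 exceeds (v
   tau)^2 < 1/16. *)
assert (HE : forall s v, strip J delta s v -> Ess k w s v < 0).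
{ intros s v [Hs Hv]; rewrite (Ess_frenet J k w tau Htau) by exact Hs.
  destruct (HJ s Hs) as (_ & HkM & HtM).
  assert (HdM : delta * M = / 4) by (unfold delta; field; lra).
  assert (Hva : Rabs v < delta) by (apply Rabs_def1; lra).
  assert (Hb : forall x, Rabs x < M -> - / 4 < v * x < / 4).
  { intros x Hx; apply and_comm, Rabs_def2.
    rewrite Rabs_mult, <- HdM; apply Rmult_le_0_lt_compat; trivial; apply Rabs_pos. }
  pose proof (Hb _ HkM); pose proof (Hb _ HtM); nra. }
exists (- eps), eps, (-1), 1, 1, (frame_vector Ugamma y), (frame_vector UT y),
  (frame_vector UN y), (frame_vector UB y), k, tau, delta.
cbv zeta; fold J.
split; [simpl; lra |].
split; [reflexivity |].
split; [exact Hfr |].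
split; [exact Hdelta |].
split; [eapply ruled_immersion; eassumption |].
split; [eapply ruled_lorentz; eassumption |].
exists (ruled_connection k w).
split; [eapply ruled_levi_civita; eassumption |].
split; [split |].
- eapply base_curve_triharmonic; eassumption.
- eapply base_curve_not_geodesic; [eassumption .. | rewrite k0; lra].
- exists k; split.
  + eapply base_curve_frenet_in_surface; eassumption.
  + eapply base_curve_non_constant; [eassumption .. | |]; rewrite ?k0, ?w0; lra.
Qed.
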